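(* Let $X$ be a set with $|X|\geq 2$ and let $\mathcal{B} \subset \mathrm{Br}(X)$ be a Hall set. For every $n \geq 3$, there exist $a < b \in \mathcal{B}$ such that $|a| = 1$, $|b| = n - 1$ (so $|a| + |b| = n$) and $$\| [a, b] \|_{\mathcal{B}} \geq \begin{cases} 2^{n-2} & \text{when } |X| \geq 3, \\ F_{n-2} & \text{when } |X| = 2, \end{cases}$$ where $(F_\nu)_{\nu \in \mathbb{N}}$ denotes the Fibonacci numbers ($F_0=0$, $F_1=1$, $F_{\nu+2}=F_{\nu+1}+F_\nu$).
   Context: The base field is $\mathbb{K}=\mathbb{R}$ or $\mathbb{C}$; $X$ is a set (possibly infinite) with at least two elements. $\mathrm{Br}(X)$ is the free magma over $X$: the set of formal binary brackets (rooted planar binary trees with leaves labelled by elements of $X$), with product $(t_1,t_2)$. For $t\in \mathrm{Br}(X)$, $|t|$ is its number of leaves; if $t\notin X$, $t$ is written uniquely as $t=(\lambda(t),\mu(t))$. $\mathcal{L}(X)$ is the free Lie algebra over $X$ and $\mathrm{ev}:\mathrm{Br}(X)\to\mathcal{L}(X)$ is the canonical evaluation ($\mathrm{ev}(x)=x$ for $x\in X$, $\mathrm{ev}((t_1,t_2))=[\mathrm{ev}(t_1),\mathrm{ev}(t_2)]$). For $a,b\in\mathrm{Br}(X)$, $[a,b]$ denotes $[\mathrm{ev}(a),\mathrm{ev}(b)]\in\mathcal{L}(X)$. A Hall set is a subset $\mathcal{B}\subset\mathrm{Br}(X)$ endowed with a total order $<$ such that: (i) $X\subset\mathcal{B}$;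 (ii) for all $b_1,b_2\in\mathrm{Br}(X)$, $(b_1,b_2)\in\mathcal{B}$ iff $b_1,b_2\in\mathcal{B}$, $b_1<b_2$ and either $b_2\in X$ or $\lambda(b_2)\leq b_1$; (iii) for all $b_1,b_2\in\mathcal{B}$ with $(b_1,b_2)\in\mathcal{B}$, $b_1<(b_1,b_2)$. By a theorem of Viennot, $\mathrm{ev}$ is injective on $\mathcal{B}$ and $\mathrm{ev}(\mathcal{B})$ is a basis of $\mathcal{L}(X)$. For $u=\sum_{c\in\mathcal{B}}\alpha_c\,\mathrm{ev}(c)\in\mathcal{L}(X)$ (finite sum), $\|u\|_{\mathcal{B}}:=\sum_{c}|\alpha_c|$. *)

(* Defs.v *)
From HB Require Import structures.
From mathcomp Require Import all_boot all_order all_algebra.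
From mathcomp Require Import finmap.
From mathcomp Require Import boolp classical_sets cardinality reals.
From mathcomp Require Import complex.

Set Implicit Arguments.
Unset Strict Implicit.
Unset Printing Implicit Defensive.

Import Order.TTheory GRing.Theory Num.Theory.

Local Open Scope ring_scope.
Local Open Scope complex_scope.

(* The norm of [R[i]] takes its values in [R[i]] itself, where [x <= y] means
   that [y - x] is a nonnegative real; on absolute values this is the usual
   order of the reals. *)
Inductive scalar_kind := RealScalars | ComplexScalars.

Definition base_field (R : realType) (k : scalar_kind) : numFieldType :=
  match k with RealScalars => R | ComplexScalars => R[i] end.

Inductive br (X : Type) : Type :=
  | Leaf of X
  | Node of br X & br X.

Arguments Leaf {X} _.
Arguments Node {X} _ _.

Fixpoint tree_of_br (X : Type) (t : br X) : GenTree.tree X :=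
  match t with
  | Leaf x => GenTree.Leaf x
  | Node l r => GenTree.Node 0 [:: tree_of_br l; tree_of_br r]
  end.

Fixpoint br_of_tree (X : Type) (t : GenTree.tree X) : option (br X) :=
  match t with
  | GenTree.Leaf x => Some (Leaf x)
  | GenTree.Node _ [:: l; r] =>
      match br_of_tree l, br_of_tree r with
      | Some l', Some r' => Some (Node l' r')
      | _, _ => None
      end
  | _ => None
  end.

Lemma tree_of_brK (X : Type) : pcancel (@tree_of_br X) (@br_of_tree X).
Proof. by elim=> //= l -> r ->. Qed.

HB.instance Definition _ (X : choiceType) :=
  Choice.copy (br X) (pcan_type (@tree_of_brK X)).

Fixpoint br_size (X : Type) (t : br X) : nat :=
  match t with
  | Leaf _ => 1
  | Node l r => br_size l + br_size r
  end.

HB.mixin Record Lmodule_isLieAlgebra (K : fieldType) L of GRing.Lmodule K L := {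
  lie : L -> L -> L;
  lie_linearl : forall z : L, linear (fun x => lie x z);
  lie_linearr : forall z : L, linear (lie z);
  liexx : forall x : L, lie x x = 0;
  lie_jacobi : forall x y z : L,
    lie x (lie y z) + lie y (lie z x) + lie z (lie x y) = 0
}.

#[short(type="lieAlgebraType")]
HB.structure Definition LieAlgebra (K : fieldType) :=
  {L of GRing.Lmodule K L & Lmodule_isLieAlgebra K L}.

Definition lie_morphism (K : fieldType) (L M : lieAlgebraType K) (f : L -> M) :=
  linear f /\ {morph f : x y / lie x y}.

(* Universal property, which determines [(L, i)] up to unique isomorphism. *)
Definition is_free_lie (K : fieldType) (X : Type) (L : lieAlgebraType K)
    (i : X -> L) : Prop :=
  forall (M : lieAlgebraType K) (f : X -> M),
    (exists g : L -> M, lie_morphism g /\ g \o i =1 f) /\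
    (forall g h : L -> M, lie_morphism g -> lie_morphism h ->
       g \o i =1 f -> h \o i =1 f -> g =1 h).

Fixpoint ev (K : fieldType) (X : Type) (L : lieAlgebraType K) (i : X -> L)
    (t : br X) : L :=
  match t with
  | Leaf x => i x
  | Node l r => lie (ev i l) (ev i r)
  end.

(* The relation [le] is only meaningful on [B]. *)
Definition total_order_on (T : choiceType) (B : set T) (le : rel T) : Prop :=
  [/\ {in B, reflexive le}, {in B &, antisymmetric le},
      {in B & &, transitive le} & {in B &, total le}].

Definition strict (T : eqType) (le : rel T) : rel T :=
  fun a b => (a != b) && le a b.

Record is_hall_set (X : choiceType) (B : set (br X)) (le : rel (br X)) : Prop := {
  hall_order : total_order_on B le;
  hall_leaf : forall x : X, B (Leaf x);
  hall_node : forall b1 b2 : br X,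
    B (Node b1 b2) <->
    [/\ B b1, B b2, strict le b1 b2
      & match b2 with Leaf _ => True | Node l _ => le l b1 end];
  hall_lt_node : forall b1 b2 : br X,
    B b1 -> B b2 -> B (Node b1 b2) -> strict le b1 (Node b1 b2)
}.

Definition hall_expansion (K : fieldType) (X : choiceType)
    (L : lieAlgebraType K) (i : X -> L) (B : set (br X)) (u : L) :
    set {fsfun br X -> K with 0} :=
  [set alpha | (forall c, c \in finsupp alpha -> B c) /\
               u = \sum_(c <- finsupp alpha) alpha c *: ev i c].

(* When [B] is a Hall set and [L] is free, [u] has exactly one expansion, so
   that the choice made by [xget] is immaterial and its default value [[fsfun]]
   is never used. *)
Definition hall_coords (K : fieldType) (X : choiceType)
    (L : lieAlgebraType K) (i : X -> L) (B : set (br X)) (u : L) :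
    {fsfun br X -> K with 0} :=
  xget [fsfun] (hall_expansion i B u).

Definition hall_norm (K : numFieldType) (X : choiceType)
    (L : lieAlgebraType K) (i : X -> L) (B : set (br X)) (u : L) : K :=
  \sum_(c <- finsupp (hall_coords i B u)) `|hall_coords i B u c|.

Fixpoint fib (n : nat) : nat :=
  match n with
  | 0 => 0
  | 1 => 1
  | (m.+1 as p).+1 => fib p + fib m
  end.

(* Main.v *)
(** Take letters x < r, and either z = x or r < z, and put D := [r, -]. The
    Hall tree of +-D^k(z) is a chain, each r being attached on the side
    dictated by the order; b is such a chain and a = x. The chain D^j(x) lies
    below r for j < p and above r for j >= p. With e := (z = x) (0 or 1), the
    elements G(c,m) = [D^c x, D^(e(c+1)+m) z] satisfy D G(c,m) = G(c,m+1) +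
    G(c+1,m-e), and, up to sign, the Hall elements of their multidegree are
    D^(m-(1+e)j) G(j,0) for j < p and G(j,m-(1+e)j) for j >= p. Applying
    G(c,m+1) = D G(c,m) - G(c+1,m-e) repeatedly expands G(0,m) on these
    elements without cancellation, with coefficients at least C(m-ej,j); these
    sum to 2^m if e = 0 and to a Fibonacci number if e = 1.

    Viennot's theorem is not needed: it is enough to have one expansion and a
    linear form which is at most 1 in absolute value on every Hall element and
    equal to the sum of the coefficients on G(0,m) up to sign.  The form factors
    through a quotient of the free Lie algebra (2-step nilpotent plus the
    derivation r) where D acts as multiplication by linear polynomials. *)
Require Import Defs.
From HB Require Import structures.
From mathcomp Require Import all_boot all_order all_algebra.
From mathcomp Require Import finmap.
From mathcomp Require Import boolp classical_sets functions cardinality reals.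
From mathcomp Require Import zify ring.
Set Implicit Arguments.
Unset Strict Implicit.
Unset Printing Implicit Defensive.
Import Order.TTheory GRing.Theory Num.Theory.
Local Open Scope ring_scope.
Local Open Scope classical_set_scope.
Local Open Scope card_scope.

(** * Expansion without cancellation *)

Section Expansion.
Variables (K : nzRingType) (V : lmodType K) (D : {linear V -> V}).
Variables (e : bool) (G : nat -> nat -> V).
Hypothesis DG : forall c m,
  D (G c m) = G c m.+1 + (if (e <= m)%N then G c.+1 (m - e)%N else 0).

(** Rung [j] applies [D] outside the pair below the threshold [p], and keeps the remaining degree
    inside the pair from [p] on. The threshold is counted from [c], so raising [c] by one lowers it
    by one. *)
Definition ladder (p c m j : nat) : V :=
  if (j < p)%N then iter (m - e.+1 * j) D (G (c + j)%N 0)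
  else G (c + j)%N (m - e.+1 * j)%N.

Lemma D_ladder (p c m j : nat) : (e.+1 * j <= m)%N ->
  D (ladder p c m j) = ladder p c m.+1 j +
    (if (p <= j)%N && (e <= m - e.+1 * j)%N then ladder p c m.+1 j.+1 else 0).
Proof.
move=> jm; rewrite /ladder ltnNge; case: (leqP p j) => pj /=.
  rewrite DG -subSn // addnS; congr (_ + _).
  rewrite ltnNge (leq_trans pj) //=; case: ifP => // em; congr (G _ _).
  by case: (e) em jm => /=; lia.
by rewrite addr0 subSn.
Qed.

Lemma ladder_shift (p c m j : nat) : (e <= m)%N ->
  ladder p c.+1 (m - e) j = ladder p.+1 c m.+1 j.+1.
Proof.
move=> em; rewrite /ladder ltnS addSnnS.
by have -> : (m - e - e.+1 * j = m.+1 - e.+1 * j.+1)%N by case: (e) em; lia.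
Qed.

(** Induction on [m] through [G c m.+1 = D (G c m) - G c.+1 (m - e)]. The sign of a rung depends
    only on [minn j p]: [D] creates a new rung only where this minimum is already constant, and the
    minus sign matches the shift of both [j] and [p] by one. Hence the coefficients add up as
    natural numbers, and Pascal's rule bounds them below. For [p = 0] the element is its own rung
    0. *)
Lemma ladder_expansion (p c m : nat) :
  exists beta : nat -> nat,
    [/\ forall j, (m < e.+1 * j)%N -> beta j = 0%N,
        forall j, ((0 < p) || (j == 0))%N -> ('C(m - e * j, j) <= beta j)%N
      & G c m = \sum_(j < m.+1) (-1) ^+ minn j p *: (ladder p c m j *+ beta j)].
Proof.
elim/ltn_ind: m p c => -[|m] IHm p c.
  exists (fun j => (j == 0)%N); split=> //.
  - by case=> [|j] //; rewrite muln0.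
  - by case=> [|j].
  - by rewrite big_ord1 /ladder muln0 addn0 subn0 min0n scale1r; case: ifP.
case: p => [|p].
  exists (fun j => (j == 0)%N); split=> //.
  - by case=> [|j] //; rewrite muln0.
  - by case=> [|j] //; rewrite bin0.
  - rewrite big_ord_recl big1 => [|j _]; last by rewrite mulr0n scaler0.
    by rewrite /ladder /= muln0 addn0 subn0 min0n scale1r addr0.
have [//|b [b0 bC Gb]] := IHm m _ p.+1 c.
have [b' [b'0 b'C Gb']] : exists b' : nat -> nat,
    [/\ forall j, (m < e + e.+1 * j)%N -> b' j = 0%N,
        forall j, ((0 < p) || (j == 0))%N -> (e <= m)%N ->
          ('C(m - e - e * j, j) <= b' j)%N
      & (if (e <= m)%N then G c.+1 (m - e)%N else 0) =
        \sum_(j < m.+1) (-1) ^+ minn j p *: (ladder p.+1 c m.+1 j.+1 *+ b' j)].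
  case: (leqP e m) => em; last first.
    exists (fun=> 0%N); split=> //.
    by rewrite big1 // => j _; rewrite scaler0.
  have [|b' [b'0 b'C Gb']] := IHm (m - e)%N _ p c.+1; first lia.
  exists b'; split.
  - by move=> j mj; apply: b'0; lia.
  - by move=> j pj _; apply: b'C.
  rewrite Gb' (big_ord_widen m.+1 (fun j => (-1) ^+ minn j p *:
    (ladder p c.+1 (m - e) j *+ b' j))); last lia.
  rewrite [RHS](bigID (fun j : 'I_m.+1 => (j < (m - e).+1)%N)) /=.
  rewrite [X in _ = _ + X]big1 => [|j jm]; last first.
    by rewrite b'0 ?scaler0 //; move: jm; case: (e) em => /=; lia.
  by rewrite addr0; apply: eq_bigr => j _; rewrite ladder_shift.
(* [top j] tells when [D] applied to rung [j] also produces rung [j.+1]. *)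
pose top j := (p < j)%N && (e.+1 * j.+1 <= m.+1)%N.
pose d j := ((if top j then b j else 0) + b' j)%N.
exists (fun j => b j + (if j is j'.+1 then d j' else 0))%N; split.
- move=> j mj; rewrite b0; last by case: (e) mj => /=; lia.
  case: j mj => // j mj; rewrite /d /top (leqNgt _ m.+1) mj andbF b'0 //.
  by case: (e) mj => /=; lia.
- move=> j _; case: j => [|j].
    by rewrite addn0 bin0 -(bin0 (m - e * 0)) bC.
  have [jm|mj] := leqP (e.+1 * j.+1) m.+1; last first.
    by rewrite bin_small //; case: (e) mj; lia.
  have -> : (m.+1 - e * j.+1 = (m - e * j.+1).+1)%N by case: (e) jm; lia.
  rewrite binS leq_add ?bC // /d /top jm andbT.
  (* The second term of Pascal's rule is supplied by [b'], except for [p = 0 < j]; then rung [j] has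
     reached the threshold [p.+1 = 1], and [b j] supplies it. *)
  have [pj|] := boolP ((0 < p) || (j == 0))%N.
    have em : (e <= m)%N by lia.
    apply: leq_trans (leq_trans (b'C _ pj em) (leq_addl _ _)).
    by rewrite leq_bin2l //; lia.
  rewrite negb_or -leqNgt leqn0 => /andP[/eqP p0 j0].
  rewrite p0 lt0n j0 (leq_trans _ (leq_addr _ _)) //.
  by rewrite (leq_trans _ (bC _ _)) // leq_bin2l //; case: (e) => /=; lia.
have -> : G c m.+1 = D (G c m) - (if (e <= m)%N then G c.+1 (m - e)%N else 0).
  by rewrite DG addrK.
rewrite {1}Gb Gb' linear_sum /=.
pose s j : K := (-1) ^+ minn j p.+1; pose E := ladder p.+1 c m.+1.
have -> : \sum_(j < m.+1)
      D ((-1) ^+ minn j p.+1 *: (ladder p.+1 c m j *+ b j)) =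
    \sum_(j < m.+1) s j *: (E j *+ b j) +
    \sum_(j < m.+1) s j.+1 *: (E j.+1 *+ (if top j then b j else 0)).
  rewrite -big_split /=; apply: eq_bigr => j _.
  rewrite linearZ linearMn /=; have [jm|mj] := leqP (e.+1 * j) m; last first.
    by rewrite b0 // if_same !mulr0n !scaler0 addr0.
  rewrite D_ladder // mulrnDl scalerDr; congr (_ + _).
  have -> : top j = (p < j)%N && (e <= m - e.+1 * j)%N.
    by rewrite /top; congr (_ && _); case: (e) jm => /=; lia.
  case: ifP => [/andP[pj _]|]; last by rewrite mul0rn mulr0n !scaler0.
  by congr (_ *: _); rewrite /s; congr (_ ^+ _); lia.
have -> : \sum_(j < m.+1) (-1) ^+ minn j p *: (E j.+1 *+ b' j) =
    - \sum_(j < m.+1) s j.+1 *: (E j.+1 *+ b' j).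
  rewrite -sumrN; apply: eq_bigr => j _.
  by rewrite /s minnSS exprS mulN1r scaleNr opprK.
rewrite opprK -addrA -big_split /=.
under [X in _ + X = _]eq_bigr do rewrite -scalerDr -mulrnDr.
transitivity (\sum_(j < m.+2) s j *: (E j *+ b j) +
   \sum_(j < m.+2) s j *: (E j *+ (if nat_of_ord j is j'.+1 then d j' else 0))).
  rewrite [in RHS]big_ord_recr /= b0 ?mulr0n ?scaler0 ?addr0; last first.
    by case: (e); lia.
  by rewrite [X in _ = _ + X]big_ord_recl mulr0n scaler0 add0r.
by rewrite -big_split /=; apply: eq_bigr => j _; rewrite -scalerDr -mulrnDr.
Qed.
End Expansion.

(** * Chains in a Hall set *)

Definition eq_up_to_sign (V : zmodType) (u v : V) : Prop := u = v \/ u = - v.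

(** * Signs and derivations in a Lie algebra *)

Section LieAlgebra.
Variables (K : fieldType) (L : lieAlgebraType K).
Implicit Types (a b c : L).

HB.instance Definition _ (r : L) :=
  GRing.isLinear.Build K L L *:%R (lie r) (lie_linearr r).

Lemma lie0r a : lie a 0 = 0. Proof. exact: linear0. Qed.

Lemma lieNr a b : lie a (- b) = - lie a b. Proof. exact: linearN. Qed.

Lemma lie_anti a b : lie a b = - lie b a.
Proof.
apply/eqP; rewrite -addr_eq0; apply/eqP.
have linl c : lie (a + b) c = lie a c + lie b c.
  by have := lie_linearl c 1 a b; rewrite !scale1r.
by have := liexx (a + b); rewrite linearD /= !linl !liexx add0r addr0 addrC.
Qed.

Lemma lie0l a : lie 0 a = 0. Proof. by rewrite lie_anti lie0r oppr0. Qed.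

Lemma lieNl a b : lie (- a) b = - lie a b.
Proof. by rewrite lie_anti lieNr opprK lie_anti. Qed.

Lemma lie_derivation r a b :
  lie r (lie a b) = lie (lie r a) b + lie a (lie r b).
Proof.
have /eqP := lie_jacobi r a b; rewrite -addrA addr_eq0 => /eqP ->.
by rewrite opprD addrC [in RHS](lie_anti (lie r a)) (lie_anti b r) lieNr opprK.
Qed.

Lemma eq_up_to_sign_lie a a' b b' :
  eq_up_to_sign a a' -> eq_up_to_sign b b' ->
  eq_up_to_sign (lie a b) (lie a' b').
Proof.
by case=> ->; case=> ->; rewrite ?lieNl ?lieNr ?opprK; [left|right|right|left].
Qed.

Lemma eq_up_to_sign_lieC a a' b b' :
  eq_up_to_sign a a' -> eq_up_to_sign b b' ->
  eq_up_to_sign (lie b a) (lie a' b').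
Proof.
move=> ha hb; rewrite /eq_up_to_sign (lie_anti b a).
by case: (eq_up_to_sign_lie ha hb) => ->; rewrite ?opprK; [right|left].
Qed.

(** When [z = x], antisymmetry leaves only the pairs whose second exponent exceeds [c]; the offset
    [e * c.+1] starts counting there. *)
Definition lie_pair (r x z : L) (e : bool) (c m : nat) : L :=
  lie (iter c (lie r) x) (iter (e * c.+1 + m) (lie r) z).

(** Leibniz rule. When [e] holds and [m = 0], the extra term is a bracket of an element with itself,
    hence the guard [e <= m]. *)
Lemma lie_pair_derivation (r x z : L) (e : bool) (c m : nat) :
  (e -> z = x) ->
  lie r (lie_pair r x z e c m) = lie_pair r x z e c m.+1 +
    (if (e <= m)%N then lie_pair r x z e c.+1 (m - e) else 0).
Proof.
move=> ezx; rewrite /lie_pair lie_derivation addrC -!iterS addnS; congr (_ + _).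
case: e ezx => [->//|_]; last by rewrite subn0.
rewrite !mul1n; case: m => [|m] /=; first by rewrite addn0 liexx.
by rewrite subn1 addnS.
Qed.

End LieAlgebra.

(** * Iterated brackets with a letter [r] and their position in the order *)

Section HallOrder.
Variables (X : choiceType) (B : set (br X)) (le : rel (br X)).
Hypothesis hallB : is_hall_set B le.
Implicit Types (s t u : br X).

Lemma hall_lexx t : B t -> le t t.
Proof. by case: hallB => -[h _ _ _] _ _ _ Bt; apply: h; rewrite inE. Qed.

Lemma hall_le_anti s t : B s -> B t -> le s t -> le t s -> s = t.
Proof.
case: hallB => -[_ h _ _] _ _ _ Bs Bt st ts.
by apply: h; rewrite ?inE ?st.
Qed.

Lemma hall_le_trans s t u : B s -> B t -> B u -> le s t -> le t u -> le s u.
Proof. by case: hallB => -[_ _ h _] _ _ _ *; apply: (h t); rewrite ?inE. Qed.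

Lemma hall_le_total s t : B s -> B t -> le s t || le t s.
Proof. by case: hallB => -[_ _ _ h] _ _ _ *; apply: h; rewrite inE. Qed.

Lemma hall_ltW s t : strict le s t -> le s t. Proof. by case/andP. Qed.

Lemma hall_ltN s t : B s -> B t -> strict le s t -> le t s -> False.
Proof.
move=> Bs Bt /andP[/negP st le_st] le_ts; apply: st.
by rewrite (hall_le_anti Bs Bt le_st le_ts).
Qed.

Lemma hall_nle s t : B s -> B t -> le s t = false -> strict le t s.
Proof.
move=> Bs Bt st; have := hall_le_total Bs Bt; rewrite st /= => ts.
by rewrite /strict ts andbT; apply: contraFneq st => <-; rewrite hall_lexx.
Qed.

Lemma hall_le_lt_trans s t u :
  B s -> B t -> B u -> le s t -> strict le t u -> strict le s u.
Proof.
move=> Bs Bt Bu st tu; apply: hall_nle => //; apply/negP => us.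
by apply: (hall_ltN Bt Bu tu); apply: hall_le_trans us st.
Qed.

Lemma hall_lt_trans s t u :
  B s -> B t -> B u -> strict le s t -> strict le t u -> strict le s u.
Proof. by move=> Bs Bt Bu /hall_ltW; apply: hall_le_lt_trans. Qed.

Variable r : X.

(** The only order of the two factors in which the bracket of [t] and [r] can be a Hall tree. *)
Definition ad_tree t : br X :=
  if le t (Leaf r) then Node t (Leaf r) else Node (Leaf r) t.

Definition ad_chain k t : br X := iter k ad_tree t.

(* Besides [t != Leaf r], the condition [hall_node] requires of [t] for
   [Node (Leaf r) t]. *)
Definition ad_ready t : Prop :=
  t != Leaf r /\ if t is Node l _ then le l (Leaf r) else true.

(** Both possible left factors are at most [r], so bracketing with [r] can be repeated
    indefinitely. *)
Lemma ad_tree_ready t : ad_ready (ad_tree t).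
Proof.
rewrite /ad_ready /ad_tree; case: ifP => //= _; split=> //.
by rewrite hall_lexx //; apply: hall_leaf hallB _.
Qed.

Lemma ad_tree_hall t : B t -> ad_ready t -> B (ad_tree t).
Proof.
have Br := hall_leaf hallB r; move=> Bt [tr ok].
rewrite /ad_tree; case: ifP => [le_tr|/hall_nle lt_rt]; apply/(hall_node hallB).
  by rewrite /strict tr le_tr.
by split=> //; [exact: lt_rt|case: t ok {Bt tr lt_rt}].
Qed.

Lemma ad_chain_hall k t : B t -> ad_ready t ->
  B (ad_chain k t) /\ ad_ready (ad_chain k t).
Proof.
move=> Bt ok; elim: k => //= k [Bk okk].
by split; [exact: ad_tree_hall|exact: ad_tree_ready].
Qed.

Lemma br_size_ad_chain k t : br_size (ad_chain k t) = (k + br_size t)%N.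
Proof.
elim: k => //= k IHk; rewrite /ad_tree addSn -IHk.
by case: ifP => _ /=; rewrite ?addn1 ?add1n.
Qed.

(** By [hall_lt_node] a tree exceeds its left factor, which is [r] here and [t] in [ad_tree_below]:
    a chain climbs until it passes [r], then stays above [r]. *)
Lemma ad_tree_above t : B t -> ad_ready t -> strict le (Leaf r) t ->
  strict le (Leaf r) (ad_tree t).
Proof.
have Br := hall_leaf hallB r; move=> Bt ok rt.
have := ad_tree_hall Bt ok; rewrite /ad_tree; case: ifP => [tr|_ BN].
  by case: (hall_ltN Br Bt rt tr).
by apply: (hall_lt_node hallB).
Qed.

Lemma ad_tree_below t : B t -> ad_ready t -> le t (Leaf r) ->
  strict le t (ad_tree t).
Proof.
have Br := hall_leaf hallB r; move=> Bt ok tr.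
have := ad_tree_hall Bt ok; rewrite /ad_tree tr => BN.
by apply: (hall_lt_node hallB).
Qed.

Lemma ad_chain_above j k t : B t -> ad_ready t -> (j <= k)%N ->
  strict le (Leaf r) (ad_chain j t) -> strict le (Leaf r) (ad_chain k t).
Proof.
move=> Bt ok /subnK <- rj; elim: (k - j)%N => // l IHl.
by have [Bl okl] := ad_chain_hall (l + j) Bt ok; apply: ad_tree_above.
Qed.

Lemma ad_chain_below j k t : B t -> ad_ready t -> (j <= k)%N ->
  le (ad_chain k t) (Leaf r) -> le (ad_chain j t) (Leaf r).
Proof.
have Br := hall_leaf hallB r; move=> Bt ok jk kr; apply: contraT => /negbTE.
have [Bj _] := ad_chain_hall j Bt ok; have [Bk _] := ad_chain_hall k Bt ok.
move/(hall_nle Bj Br)/(ad_chain_above Bt ok jk) => rk.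
by case: (hall_ltN Br Bk rk kr).
Qed.

Lemma ad_chain_increasing j k t : B t -> ad_ready t -> (j < k)%N ->
  le (ad_chain k.-1 t) (Leaf r) -> strict le (ad_chain j t) (ad_chain k t).
Proof.
move=> Bt ok; have Bc i := ad_chain_hall i Bt ok.
elim: k => //= k IHk; rewrite ltnS leq_eqVlt => /orP[/eqP -> kr|jk kr].
  by have [Bk okk] := Bc k; apply: ad_tree_below.
have [[Bj _] [Bk okk]] := (Bc j, Bc k); have [BSk _] := Bc k.+1.
have jk' : strict le (ad_chain j t) (ad_chain k t).
  by apply: IHk => //; apply: ad_chain_below kr => //; apply: leq_pred.
exact (hall_lt_trans Bj Bk BSk jk' (ad_tree_below Bk okk kr)).
Qed.

(** A chain crosses [r] at most once, by [ad_chain_below]. The bound [N] keeps [p] finite for chains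
    that never cross. *)
Lemma ad_chain_threshold (N : nat) t : B t -> ad_ready t -> exists p,
  forall j, (j <= N)%N -> (j < p)%N = le (ad_chain j t) (Leaf r).
Proof.
move=> Bt ok; elim: N => [|N [p Hp]].
  exists (le (ad_chain 0 t) (Leaf r)); case=> //= _; by case: le.
have [le_N|gt_N] := boolP (le (ad_chain N.+1 t) (Leaf r)).
  exists N.+2 => j jN; rewrite ltnS jN; apply/esym.
  exact: ad_chain_below le_N.
exists (minn p N.+1) => j; rewrite leq_eqVlt leq_min => /orP[/eqP ->|jN].
  by rewrite ltnn andbF; apply/esym/negbTE.
by rewrite jN andbT Hp.
Qed.

End HallOrder.

(** * Hall trees representing the rungs of the ladder *)

Section HallPairs.
Variables (X : choiceType) (B : set (br X)) (le : rel (br X)).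
Hypothesis hallB : is_hall_set B le.
Variables (x r z : X).
Hypothesis lt_xr : strict le (Leaf x) (Leaf r).
Hypothesis z_or : z = x \/ strict le (Leaf r) (Leaf z).

Let e := z == x.
Let Br : B (Leaf r) := hall_leaf hallB r.
Let chain k y := ad_chain le r k (Leaf y).

Lemma neq_xr : x != r.
Proof. by apply: contraTN lt_xr => /eqP ->; rewrite /strict eqxx. Qed.

Lemma neq_zr : z != r.
Proof.
case: z_or => [->|]; first exact: neq_xr.
by apply: contraTN => /eqP ->; rewrite /strict eqxx.
Qed.

Lemma neq_zx : strict le (Leaf r) (Leaf z) -> (z == x) = false.
Proof.
move=> lt_rz; apply: contraTF lt_rz => /eqP ->; apply/negP.
move/(hall_ltN hallB Br (hall_leaf hallB x)); apply; exact: hall_ltW lt_xr.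
Qed.

Lemma leaf_ready y : y != r -> ad_ready le r (Leaf y).
Proof. by move=> yr; split=> //; apply: contra yr => /eqP[->]. Qed.

Lemma chain_hall k y : y != r -> B (chain k y) /\ ad_ready le r (chain k y).
Proof.
move=> yr; apply: ad_chain_hall => //; first exact: hall_leaf hallB _.
exact: leaf_ready.
Qed.

(** Serves to read the starting letter off a chain; the length is read off the size. *)
Fixpoint br_has (y : X) (t : br X) : bool :=
  match t with
  | Leaf y' => y' == y
  | Node s1 s2 => br_has y s1 || br_has y s2
  end.

Lemma br_has_chain k y y' : y' != r -> br_has y' (chain k y) = (y == y').
Proof.
move=> y'r; elim: k => //= k IHk; rewrite /ad_tree.
by case: ifP => _ /=; rewrite IHk [r == y']eq_sym (negbTE y'r) ?orbF.
Qed.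

Lemma chain_inj k k' y y' :
  y != r -> chain k y = chain k' y' -> k = k' /\ y' = y.
Proof.
move=> yr eqc; split.
  have /eqP := congr1 (@br_size X) eqc.
  by rewrite !br_size_ad_chain eqn_add2r => /eqP.
by have := congr1 (br_has y) eqc; rewrite !br_has_chain // eqxx => /esym/eqP.
Qed.

Variables (K : fieldType) (L : lieAlgebraType K) (i : X -> L).

Lemma ev_ad_tree t : eq_up_to_sign (ev i (ad_tree le r t)) (lie (i r) (ev i t)).
Proof.
by rewrite /ad_tree; case: ifP => _ /=; [right; apply: lie_anti|left].
Qed.

Lemma ev_ad_chain k t :
  eq_up_to_sign (ev i (ad_chain le r k t)) (iter k (lie (i r)) (ev i t)).
Proof.
elim: k => [|k IHk]; first by left.
rewrite /=; case: (ev_ad_tree (ad_chain le r k t)); case: IHk => ->;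
  rewrite ?lieNr => ->.
- by left.
- by right.
- by right.
- by rewrite opprK; left.
Qed.

Lemma node_hall s t : B s -> B t -> s != t ->
  (strict le s t -> if t is Node l _ then le l s else true) ->
  (strict le t s -> if s is Node l _ then le l t else true) ->
  exists c, B c /\ (c = Node s t \/ c = Node t s).
Proof.
move=> Bs Bt st hst hts; have [le_st|le_ts] := boolP (le s t).
  have lt_st : strict le s t by rewrite /strict st.
  exists (Node s t); split; last by left.
  by apply/(hall_node hallB); split=> //; have := hst lt_st; case: (t).
have lt_ts : strict le t s by apply: (hall_nle hallB) => //; apply: negbTE.
exists (Node t s); split; last by right.
by apply/(hall_node hallB); split=> //; have := hts lt_ts; case: (s).
Qed.

(** If [chain j x] is at most [r], its bracket with the shortest admissible chain over [z] is Hall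
    and has a left factor at most [r], so a chain can start from it. Otherwise both chains lie above
    [r] while their own left factors are at most [r], so the order alone decides which bracket is
    Hall. *)
Lemma ladder_hall (p m j : nat) :
  (forall j, (j <= m)%N -> (j < p)%N = le (chain j x) (Leaf r)) ->
  (e.+1 * j <= m)%N ->
  exists c, B c /\ eq_up_to_sign (ev i c)
    (ladder (lie (i r)) e (lie_pair (i r) (i x) (i z) e) p 0 m j).
Proof.
move=> Hp jm; rewrite /ladder add0n.
have jm' : (j <= m)%N by case: (e) jm; lia.
have [Bj [neq_j okj]] := chain_hall j neq_xr.
rewrite Hp //; case: ifP => [le_j|/(hall_nle hallB Bj Br) gt_j].
  set k := (e * j.+1)%N; have [Bk _] := chain_hall k neq_zr.
  pose t := Node (chain j x) (chain k z).
  have Bt : B t.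
    apply/(hall_node hallB); split=> //.
      rewrite /k; case: (z_or) => [zx|rz].
        rewrite /e zx eqxx mul1n; apply: (ad_chain_increasing hallB) => //.
          exact: hall_leaf hallB _.
        exact: leaf_ready neq_xr.
      rewrite /e neq_zx // mul0n.
      apply: (hall_le_lt_trans hallB _ _ _ _ rz) => //.
      exact: hall_leaf hallB _.
    (* For [z = x] the right factor is [chain j x] bracketed with [r], so its left factor equals the
       left factor of [t]. *)
    rewrite /k /e; have [->|//] := eqVneq z x; rewrite mul1n /chain /= /ad_tree.
    by rewrite le_j; apply: (hall_lexx hallB).
  have okt : ad_ready le r t by [].
  have [Bc _] := ad_chain_hall hallB (m - e.+1 * j) Bt okt.
  exists (ad_chain le r (m - e.+1 * j) t); split=> //.
  have := ev_ad_chain (m - e.+1 * j) t; rewrite /lie_pair addn0 -/k /=.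
  have := eq_up_to_sign_lie (ev_ad_chain j (Leaf x)) (ev_ad_chain k (Leaf z)).
  rewrite /= -/chain; case=> -> //.
  have -> n u : iter n (lie (i r)) (- u) = - iter n (lie (i r)) u.
    by elim: n => //= n ->; rewrite lieNr.
  by case=> ->; [right|left; rewrite opprK].
set k := (e * j.+1 + (m - e.+1 * j))%N.
have [Bk [neq_k okk]] := chain_hall k neq_zr.
have gt_k : strict le (Leaf r) (chain k z).
  have Bl y := hall_leaf hallB y; have okl := leaf_ready.
  case: (z_or) => [zx|rz]; last first.
    by apply: (ad_chain_above hallB (j := 0)) => //; exact/okl/neq_zr.
  rewrite zx; apply: (ad_chain_above hallB (j := j)) => //.
    exact/okl/neq_xr.
  by rewrite /k /e zx eqxx; lia.
have [|||c [Bc Ec]] := node_hall Bj Bk.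
- apply/eqP => /(chain_inj neq_xr)[jk zx]; move: jk; rewrite /k /e zx eqxx; lia.
- move=> _; case: (chain k z) okk Bk => // l l' lr BN.
  have [Bl _ _ _] := (hall_node hallB l l').1 BN.
  exact: hall_le_trans Bl Br Bj lr (hall_ltW gt_j).
- move=> _; case: (chain j x) okj Bj => // l l' lr BN.
  have [Bl _ _ _] := (hall_node hallB l l').1 BN.
  exact: hall_le_trans Bl Br Bk lr (hall_ltW gt_k).
exists c; split=> //; case: Ec => -> /=.
  exact: eq_up_to_sign_lie (ev_ad_chain j (Leaf x)) (ev_ad_chain k (Leaf z)).
exact: eq_up_to_sign_lieC (ev_ad_chain j (Leaf x)) (ev_ad_chain k (Leaf z)).
Qed.

End HallPairs.

(** * The model Lie algebra *)

Section UnitriangularDual.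
Variable K : fieldType.

(** The coefficients of the [g j] form a triangular matrix with unit diagonal, which is invertible;
    a linear form on coefficients can therefore take prescribed values on them. *)
Lemma unitriangular_dual (n : nat) (g : nat -> {poly K}) (tau : nat -> K) :
  (forall j i, (i <= j <= n)%N -> (g j)`_i = (i == j)%:R) ->
  exists mu : nat -> K,
    forall j, (j <= n)%N -> \sum_(i < n.+1) mu i * (g j)`_i = tau j.
Proof.
move=> Hg; pose M : 'M[K]_n.+1 := \matrix_(i, j) (g j)`_i.
have trigM : is_trig_mx M.
  apply/is_trig_mxP => i j ij; rewrite mxE Hg; first by rewrite ltn_eqF.
  by rewrite (ltnW ij) -ltnS ltn_ord.
have unitM : M \in unitmx.
  rewrite unitmxE det_trig // big1 ?unitr1 // => i _.
  by rewrite mxE Hg ?eqxx // leqnn -ltnS ltn_ord.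
pose mu := (\row_j tau j) *m invmx M.
exists (fun i => mu ord0 (inord i)) => j; rewrite -ltnS => jn.
have := congr1 (fun v : 'rV_n.+1 => v ord0 (Ordinal jn))
  (mulmxKV unitM (\row_j tau j)).
rewrite -/mu !mxE /= => <-.
by apply: eq_bigr => i _; rewrite inord_val !mxE.
Qed.

End UnitriangularDual.

(* A quadruple stands for the multiple of the derivation [r], the parts of
   degree one in the letters [x] and [z], and the part of degree two. *)
Definition model (K : fieldType) : Type :=
  ({poly {poly K}} * {poly {poly K}} * {poly {poly K}} * {poly {poly K}})%type.

HB.instance Definition _ (K : fieldType) := GRing.Zmodule.copy (model K)
  ({poly {poly K}} * {poly {poly K}} * {poly {poly K}} * {poly {poly K}})%type.

Section Model.
Variable K : fieldType.
Implicit Types (u v : model K) (f : {poly {poly K}}).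

Definition model_scale (a : K) (v : model K) : model K :=
  let: (v0, v1, v2, v3) := v in
  (a%:P%:P * v0, a%:P%:P * v1, a%:P%:P * v2, a%:P%:P * v3).

Fact model_scaleA a b v :
  model_scale a (model_scale b v) = model_scale (a * b) v.
Proof. by case: v => [[[? ?] ?] ?] /=; rewrite !polyCM !mulrA. Qed.

Fact model_scale1 : left_id 1 model_scale.
Proof. by case=> [[[? ?] ?] ?] /=; rewrite !mul1r. Qed.

Fact model_scaleDr : right_distributive model_scale +%R.
Proof.
by move=> a [[[? ?] ?] ?] [[[? ?] ?] ?] /=; do 3?congr (_, _); exact: mulrDr.
Qed.

Fact model_scaleDl v : {morph model_scale^~ v : a b / a + b}.
Proof.
move=> a b; case: v => [[[? ?] ?] ?] /=; rewrite !polyCD.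
by do 3?congr (_, _); exact: mulrDl.
Qed.

HB.instance Definition _ := GRing.Zmodule_isLmodule.Build K (model K)
  model_scaleA model_scale1 model_scaleDr model_scaleDl.

(* [r] acts by these weights on the two parts of degree one, and by their sum
   on the part of degree two.  The outer variable records the total degree. *)
Definition weight1 : {poly {poly K}} := 'X%:P * 'X.
Definition weight2 : {poly {poly K}} := 'X.

Definition model_lie (u v : model K) : model K :=
  let: (u0, u1, u2, u3) := u in let: (v0, v1, v2, v3) := v in
  (0, weight1 * (u0 * v1 - v0 * u1), weight2 * (u0 * v2 - v0 * u2),
   (weight1 + weight2) * (u0 * v3 - v0 * u3) + (u1 * v2 - v1 * u2)).

Fact model_addE (p p' q q' s s' t t' : {poly {poly K}}) :
  ((p, q, s, t) : model K) + ((p', q', s', t') : model K) =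
  (p + p', q + q', s + s', t + t').
Proof. by []. Qed.

Fact model_oppE (p q s t : {poly {poly K}}) :
  - ((p, q, s, t) : model K) = (- p, - q, - s, - t).
Proof. by []. Qed.

Fact model_scaleE a (p q s t : {poly {poly K}}) :
  a *: ((p, q, s, t) : model K) =
  (a%:P%:P * p, a%:P%:P * q, a%:P%:P * s, a%:P%:P * t).
Proof. by []. Qed.

Fact model_lie_linearl v : linear (fun u => model_lie u v).
Proof.
move=> a [[[u0 u1] u2] u3] [[[w0 w1] w2] w3]; case: v => [[[v0 v1] v2] v3].
rewrite /model_lie !(model_scaleE, model_addE).
by congr (_, _, _, _); ring.
Qed.

Fact model_liexx v : model_lie v v = 0.
Proof.
by case: v => [[[v0 v1] v2] v3] /=; rewrite ![_ * _ - _]subrr !mulr0 addr0.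
Qed.

Fact model_lie_anti u v : model_lie u v = - model_lie v u.
Proof.
case: u => [[[u0 u1] u2] u3]; case: v => [[[v0 v1] v2] v3].
rewrite /model_lie model_oppE.
by congr (_, _, _, _); ring.
Qed.

Fact model_lie_linearr u : linear (model_lie u).
Proof.
move=> a v w; rewrite model_lie_anti model_lie_linearl opprD -scalerN.
by rewrite -!model_lie_anti.
Qed.

Fact model_lie_jacobi u v w :
  model_lie u (model_lie v w) + model_lie v (model_lie w u)
  + model_lie w (model_lie u v) = 0.
Proof.
case: u => [[[u0 u1] u2] u3]; case: v => [[[v0 v1] v2] v3].
case: w => [[[w0 w1] w2] w3].
have -> : 0 = ((0, 0, 0, 0) : model K) by [].
rewrite /model_lie !model_addE /=.
by congr (_, _, _, _); ring.
Qed.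

HB.instance Definition _ := Lmodule_isLieAlgebra.Build K (model K)
  model_lie_linearl model_lie_linearr model_liexx model_lie_jacobi.

End Model.

(** * Values of the Hall trees in the model *)

Section HallModel.
Variables (X : choiceType) (B : set (br X)) (le : rel (br X)).
Hypothesis hallB : is_hall_set B le.
Variables (x r z : X).
Hypothesis lt_xr : strict le (Leaf x) (Leaf r).
Hypothesis z_or : z = x \/ strict le (Leaf r) (Leaf z).
Variable K : fieldType.

Let e := z == x.
Let Br : B (Leaf r) := hall_leaf hallB r.
Let chain k y := ad_chain le r k (Leaf y).
Let w1 := weight1 K.
Let w2 := weight2 K.
Let xr : x != r := neq_xr lt_xr.
Let zr : z != r := neq_zr lt_xr z_or.

(** When [z = x] this letter has both parts of degree one equal to 1. Letters other than [x], [r],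
    [z] are sent to 0. *)
Definition model_gen (y : X) : model K :=
  if y == r then (1, 0, 0, 0) else (0, (y == x)%:R, (y == z)%:R, 0).

Definition central (f : {poly {poly K}}) : model K := (0, 0, 0, f).

(** Central part of the bracket of [D^j x] and [D^k z], where [D] is the bracket with [r]: a
    monomial if [z] differs from [x], antisymmetric in [j] and [k] otherwise. *)
Definition pair_value (j k : nat) : {poly {poly K}} :=
  w1 ^+ j * w2 ^+ k - e%:R * (w1 ^+ k * w2 ^+ j).

Lemma model_lieE (u v : model K) : lie u v = model_lie u v. Proof. by []. Qed.

Lemma iter_ad_gen k y : y != r ->
  iter k (lie (model_gen r)) (model_gen y) =
  (0, w1 ^+ k * (y == x)%:R, w2 ^+ k * (y == z)%:R, 0).
Proof.
move=> yr; elim: k => [|k IHk].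
  by rewrite /= /model_gen (negbTE yr) !expr0 !mul1r.
rewrite iterS IHk model_lieE /model_gen eqxx /= !exprS.
by congr (_, _, _, _); rewrite -/w1 -/w2; ring.
Qed.

Lemma iter_ad_central l f :
  iter l (lie (model_gen r)) (central f) = central ((w1 + w2) ^+ l * f).
Proof.
elim: l => [|l IHl]; first by rewrite expr0 mul1r.
rewrite iterS IHl model_lieE /model_gen eqxx /= exprS.
by congr (_, _, _, _); rewrite -/w1 -/w2; ring.
Qed.

Lemma lie_iter_gen j k :
  lie (iter j (lie (model_gen r)) (model_gen x))
      (iter k (lie (model_gen r)) (model_gen z)) = central (pair_value j k).
Proof.
rewrite !iter_ad_gen // model_lieE /= /pair_value !eqxx /e [x == z]eq_sym.
congr (_, _, _, _); try ring.
by case: (z == x) => /=; ring.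
Qed.

Lemma eq_up_to_sign_central c f s t :
  eq_up_to_sign (ev model_gen s) (central f) ->
  (c = Node (Leaf r) s \/ c = Node s (Leaf r)) -> t = (w1 + w2) * f ->
  eq_up_to_sign (ev model_gen c) (central t).
Proof.
move=> hs hc ->.
have <- : lie (model_gen r) (central f) = central ((w1 + w2) * f).
  exact: (iter_ad_central 1).
have hr : eq_up_to_sign (model_gen r) (model_gen r) by left.
by case: hc => ->; [exact: eq_up_to_sign_lie|exact: eq_up_to_sign_lieC].
Qed.

(* The side conditions of [ShapeHigh] prevent a further bracket with [r]. *)
Inductive hall_shape (c : br X) : Prop :=
| ShapeLeaf of c = Leaf r
| ShapeChain k y of y = x \/ y = z & c = chain k y
| ShapeZero of ev model_gen c = 0
| ShapeLow j l of le (chain j x) (Leaf r) &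
    eq_up_to_sign (ev model_gen c)
      (central ((w1 + w2) ^+ l * pair_value j (e * j.+1)))
| ShapeHigh j k of strict le (Leaf r) (chain j x) & e ==> (j < k)%N &
    eq_up_to_sign (ev model_gen c) (central (pair_value j k)) &
    strict le (Leaf r) c &
    if c is Node l _ then strict le (Leaf r) l else false.

Lemma ev_shape c : hall_shape c -> c = Leaf r \/
  exists a b f, ev model_gen c = (0, a, b, f) :> model K.
Proof.
case=> [->|k y yxz ->|->|j l _ []->|j k _ _ []-> _ _]; try by left.
- right; have yr : y != r by case: yxz => ->.
  have := ev_ad_chain le r model_gen k (Leaf y).
  rewrite [ev _ (Leaf y)]/= iter_ad_gen //.
  by case=> ->; do 3?eexists; [|rewrite model_oppE oppr0].
- by right; exists 0, 0, 0.
- by right; exists 0, 0; eexists.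
- by right; exists 0, 0; eexists; rewrite model_oppE oppr0.
- by right; exists 0, 0; eexists.
- by right; exists 0, 0; eexists; rewrite model_oppE oppr0.
Qed.

Lemma lie_central (a b f g : {poly {poly K}}) :
  lie ((0, a, b, f) : model K) (central g) = 0.
Proof. by rewrite model_lieE; congr (_, _, _, _) => /=; ring. Qed.


Lemma ev_pair j k : eq_up_to_sign
  (ev model_gen (Node (chain j x) (chain k z))) (central (pair_value j k)).
Proof. rewrite -lie_iter_gen; apply: eq_up_to_sign_lie; exact: ev_ad_chain. Qed.

Lemma ev_pairC j k : eq_up_to_sign
  (ev model_gen (Node (chain k z) (chain j x))) (central (pair_value j k)).
Proof.
rewrite -lie_iter_gen; apply: eq_up_to_sign_lieC; exact: ev_ad_chain.
Qed.

Lemma chain_neq k y : y = x \/ y = z -> [/\ B (chain k y),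
  strict le (Leaf r) (chain k y) \/ strict le (chain k y) (Leaf r) &
  y != r].
Proof.
move=> yxz; have yr : y != r by case: yxz => ->.
have [Bk [kr _]] := chain_hall hallB k yr; split=> //.
have [le_kr|/negbTE] := boolP (le (chain k y) (Leaf r)).
  by right; rewrite /strict kr.
by move/(hall_nle hallB Bk Br); left.
Qed.

Lemma node_above s t : B (Node s t) -> strict le (Leaf r) s ->
  strict le (Leaf r) (Node s t).
Proof.
move=> BN rs; have [Bs Bt _ _] := (hall_node hallB s t).1 BN.
apply: (hall_lt_trans hallB Br Bs BN rs).
exact: (hall_lt_node hallB Bs Bt BN).
Qed.

(** A left factor below [r] forces the right chain to be exactly one step longer, which is a low
    shape. A left factor above [r] puts both chains above [r]: a high shape, the smaller exponent
    being listed first. *)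
Lemma hall_shape_pair_same k1 k2 : z = x ->
  B (Node (chain k1 x) (chain k2 x)) ->
  hall_shape (Node (chain k1 x) (chain k2 x)).
Proof.
move=> zx BN; have [Bs Bt st lam] := (hall_node hallB _ _).1 BN.
have eT : e by rewrite /e zx.
have okx := leaf_ready le xr; have Bx := hall_leaf hallB x.
have [_ [s_r|r_s] _] := chain_neq k1 (or_introl (erefl x)); last first.
  have le_s := hall_ltW r_s.
  have k12 : (k1 < k2)%N.
    case: ltngtP st => // [k21|->] st; last by case/andP: st => /eqP.
    case: (hall_ltN hallB Bs Bt st); apply: hall_ltW.
    apply: (ad_chain_increasing hallB) => //.
    by apply: (ad_chain_below hallB) le_s => //; apply: leq_pred.
  (* The left factor of [chain k2 x] is the preceding chain or [r]; if [k2] were larger than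
     [k1.+1], either would exceed [chain k1 x]. *)
  have k2E : k2 = k1.+1.
    case: k2 k12 Bt st lam {BN} => // k2.
    rewrite ltnS leq_eqVlt => /orP[/eqP ->//|k12].
    move=> Bt st; rewrite /chain /= {1}/ad_tree; case: ifP => [le_k2|_] lam.
      have [Bk2 _] := chain_hall hallB k2 xr.
      case: (hall_ltN hallB Bs Bk2 _ lam).
      apply: (ad_chain_increasing hallB) => //.
      by apply: (ad_chain_below hallB) le_k2 => //; apply: leq_pred.
    by case: (hall_ltN hallB Bs Br r_s lam).
  apply: (@ShapeLow _ k1 0); first exact: le_s.
  by rewrite expr0 mul1r eT mul1n k2E -[in chain k1.+1 x]zx; apply: ev_pair.
have r_t := hall_lt_trans hallB Br Bs Bt s_r st.
case: (ltngtP k1 k2) => [k12|k21|k12].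
- apply: (@ShapeHigh _ k1 k2) => //; [by rewrite eT| |exact: node_above].
  by rewrite -[in chain k2 x]zx; apply: ev_pair.
- apply: (@ShapeHigh _ k2 k1) => //; [by rewrite eT| |exact: node_above].
  by rewrite -[in chain k1 x]zx; apply: ev_pairC.
- by move: st; rewrite k12 /strict eqxx.
Qed.

(** Chains over [z] all lie above [r], and two chains over the same letter commute in the model,
    having a single part of degree one in common. *)
Lemma hall_shape_pair_distinct k1 y1 k2 y2 :
  y1 = x \/ y1 = z -> y2 = x \/ y2 = z -> strict le (Leaf r) (Leaf z) ->
  B (Node (chain k1 y1) (chain k2 y2)) ->
  hall_shape (Node (chain k1 y1) (chain k2 y2)).
Proof.
move=> h1 h2 rz BN; have [Bs Bt st lam] := (hall_node hallB _ _).1 BN.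
have Bx := hall_leaf hallB x; have Bz := hall_leaf hallB z.
have zxF := neq_zx hallB lt_xr rz.
have eF : e = false by [].
have xzF : (x == z) = false by rewrite eq_sym.
have rQ k : strict le (Leaf r) (chain k z).
  have okz := leaf_ready le zr.
  exact: (ad_chain_above hallB Bz okz (leq0n k) rz).
have zero k k' y : y = x \/ y = z ->
    ev model_gen (Node (chain k y) (chain k' y)) = 0.
  move=> hy; have yr : y != r by case: hy => ->.
  have /= := eq_up_to_sign_lie (ev_ad_chain le r model_gen k (Leaf y))
                            (ev_ad_chain le r model_gen k' (Leaf y)).
  have -> : lie (iter k (lie (model_gen r)) (model_gen y))
                (iter k' (lie (model_gen r)) (model_gen y)) = 0.
    rewrite !iter_ad_gen // model_lieE.
    by case: hy => ->; rewrite !eqxx ?xzF ?zxF; congr (_, _, _, _) => /=; ring.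
  by case=> ->; rewrite ?oppr0.
case: h1 h2 Bs Bt st lam BN => -> [] -> Bs Bt st lam BN.
- by apply: ShapeZero; apply: zero; left.
- have [_ [r_s|s_r] _] := chain_neq k1 (or_introl (erefl x)).
    apply: (@ShapeHigh _ k1 k2) => //; first by rewrite eF.
      exact: ev_pair.
    exact: node_above.
  apply: (@ShapeLow _ k1 0); first exact: hall_ltW s_r.
  (* A longer chain over [z] has left factor [r], which is not below [chain k1 x]; so the right
     factor is the letter [z]. *)
  rewrite expr0 mul1r eF mul0n; case: k2 {Bt st BN} lam => [|k2].
    by move=> _; apply: (ev_pair _ 0).
  rewrite /chain /= {1}/ad_tree; case: ifP => [le_Q|_ le_rs].
    have [Bk2 _ _] := chain_neq k2 (or_intror (erefl z)).
    by case: (hall_ltN hallB Br Bk2 (rQ k2) le_Q).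
  by case: (hall_ltN hallB Bs Br s_r le_rs).
- have r_s := rQ k1; have r_t := hall_lt_trans hallB Br Bs Bt r_s st.
  apply: (@ShapeHigh _ k2 k1) => //; first by rewrite eF.
    exact: ev_pairC.
  exact: node_above.
- by apply: ShapeZero; apply: zero; right.
Qed.

Lemma shape_central c : hall_shape c -> [\/ c = Leaf r,
  exists k y, (y = x \/ y = z) /\ c = chain k y |
  exists f, ev model_gen c = central f].
Proof.
case=> [->|k y yxz ->|->|j l _ []->|j k _ _ []-> _ _].
- by constructor 1.
- by constructor 2; exists k, y.
- by constructor 3; exists 0.
- by constructor 3; eexists.
- by constructor 3; eexists; rewrite model_oppE oppr0.
- by constructor 3; eexists.
- by constructor 3; eexists; rewrite model_oppE oppr0.
Qed.

(** Induction on the tree. A bracket with [r] prolongs a chain or raises the exponent of a low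
    shape, and high shapes admit none. If neither factor is [r], both have no derivation part: the
    bracket vanishes once one of them is central, and otherwise it is a bracket of two chains. *)
Lemma hall_shapeP c : B c -> hall_shape c.
Proof.
elim: c => [y _|s IHs t IHt BN].
  have [->|yr] := eqVneq y r; first exact: ShapeLeaf.
  have [->|yx] := eqVneq y x; first by apply: (@ShapeChain _ 0 x); first left.
  have [->|yz] := eqVneq y z; first by apply: (@ShapeChain _ 0 z); first right.
  apply: ShapeZero.
  by rewrite /= /model_gen (negbTE yr) (negbTE yx) (negbTE yz).
have [Bs Bt st lam] := (hall_node hallB s t).1 BN.
have irr u : strict le u u -> False by rewrite /strict eqxx.
have {}IHs := IHs Bs; have {}IHt := IHt Bt.
have [sr|s_r] := eqVneq s (Leaf r).
  move: st lam BN; rewrite sr => rt lam BN.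
  case: IHt => [tr|k y yxz tE|t0|j l le_j Et|j k _ _ _ _].
  - by rewrite tr in rt; case: (irr _ rt).
  - apply: (@ShapeChain _ k.+1 y) => //.
    rewrite /chain /= -/(chain k y) -tE /ad_tree; case: ifP => // le_tr.
    by case: (hall_ltN hallB Br Bt rt le_tr).
  - by apply: ShapeZero; rewrite /= t0 lie0r.
  - apply: (@ShapeLow _ j l.+1) => //.
    by apply: (eq_up_to_sign_central Et); [left|rewrite exprS mulrA].
  - case: t Bt {IHs rt BN} lam => // u v BNt le_ur r_u.
    have [Bu _ _ _] := (hall_node hallB u v).1 BNt.
    by case: (hall_ltN hallB Br Bu r_u le_ur).
have [tr|t_r] := eqVneq t (Leaf r).
  move: st lam BN; rewrite tr => sr _ BN.
  case: IHs => [sE|k y yxz sE|s0|j l le_j Es|j k _ _ _ rs _].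
  - by rewrite sE eqxx in s_r.
  - apply: (@ShapeChain _ k.+1 y) => //.
    by rewrite /chain /= -/(chain k y) -sE /ad_tree (hall_ltW sr).
  - by apply: ShapeZero; rewrite /= s0 lie0l.
  - apply: (@ShapeLow _ j l.+1) => //.
    by apply: (eq_up_to_sign_central Es); [right|rewrite exprS mulrA].
  - by case: (hall_ltN hallB Br Bs rs (hall_ltW sr)).
have [/eqP|[a [b [f Es]]]] := ev_shape IHs; first by rewrite (negbTE s_r).
have [/eqP|[a' [b' [f' Et]]]] := ev_shape IHt; first by rewrite (negbTE t_r).
have [/eqP|[k1 [y1 [h1 sE]]]|[g Esg]] := shape_central IHs.
- by rewrite (negbTE s_r).
- have [/eqP|[k2 [y2 [h2 tE]]]|[g Etg]] := shape_central IHt.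
  + by rewrite (negbTE t_r).
  + rewrite sE tE; rewrite sE tE in BN; case: (z_or) => [zx|rz].
      have y1x : y1 = x by case: h1 => ->.
      have y2x : y2 = x by case: h2 => ->.
      by rewrite y1x y2x; rewrite y1x y2x in BN; apply: hall_shape_pair_same.
    exact: hall_shape_pair_distinct.
  + by apply: ShapeZero; rewrite /= Es Etg lie_central.
- by apply: ShapeZero; rewrite /= Et Esg lie_anti lie_central oppr0.
Qed.

End HallModel.

(** * The lower bound *)

Section Functional.
Variables (K : fieldType) (e : bool) (p m : nat).

(** Value of rung [j] in the model, stripped of the power [m + e] of the outer variable, which all
    rungs share. *)
Definition ladder_poly (j : nat) : {poly K} :=
  if (j < p)%N then (1 + 'X) ^+ (m - e.+1 * j) * ('X^j - e%:R * 'X^(e * j.+1))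
  else 'X^j - e%:R * 'X^(e * j.+1 + (m - e.+1 * j)).

(** In both cases ['X^j] factors out and leaves a polynomial with constant term 1. *)
Lemma coef_ladder_poly j i : (i <= j)%N -> (ladder_poly j)`_i = (i == j)%:R.
Proof.
have high k : (i <= j)%N -> (e -> j < k)%N ->
    ('X^j - e%:R * 'X^k : {poly K})`_i = (i == j)%:R.
  move=> ij ek; rewrite coefB coefXn; case: (e) ek => [|_].
    move=> /(_ isT) jk; rewrite mulr1n mul1r coefXn [i == k]ltn_eqF ?subr0 //.
    exact: leq_ltn_trans jk.
  by rewrite mulr0n mul0r coef0 subr0.
move=> ij; rewrite /ladder_poly; case: ifP => _; last first.
  by apply: high => //; case: (e) => // _; lia.
have -> : 'X^j - e%:R * 'X^(e * j.+1) = (1 - e%:R * 'X) * 'X^j :> {poly K}.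
  case: (e) => /=; last by rewrite mulr0n !mul0r !subr0 mul1r.
  by rewrite mulr1n mul1n exprS !mul1r mulrBl mul1r.
rewrite mulrA coefMXn; case: ltngtP ij => // -> _.
by rewrite subnn -horner_coef0 !hornerE expr1n subr0 mulr1.
Qed.

Lemma ladder_dual (tau : nat -> K) : exists mu : nat -> K,
  forall j, (e.+1 * j <= m)%N ->
    \sum_(i < (m %/ e.+1).+1) mu i * (ladder_poly j)`_i = tau j.
Proof.
have [j i /andP[ij _]|mu Hmu] :=
  @unitriangular_dual K (m %/ e.+1) ladder_poly tau.
  exact: coef_ladder_poly.
by exists mu => j jm; apply: Hmu; rewrite leq_divRL // mulnC.
Qed.

(** The outer coefficient [m + e] selects the total degree of the bracket to be bounded; [mu] then
    acts on the inner polynomial. *)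
Definition model_functional (mu : nat -> K) (v : model K) : K :=
  \sum_(i < (m %/ e.+1).+1) mu i * v.2`_(m + e)`_i.

Fact model_functional_linear mu : scalar (model_functional mu).
Proof.
move=> a [[[u0 u1] u2] u3] [[[v0 v1] v2] v3].
rewrite /model_functional mulr_sumr -big_split; apply: eq_bigr => i _ /=.
by rewrite coefD coefCM coefD coefCM; ring.
Qed.

HB.instance Definition _ mu := GRing.isLinear.Build K (model K) K *%R
  (model_functional mu) (model_functional_linear mu).

Lemma model_functional_monomial mu (q : {poly K}) d :
  model_functional mu (central (q%:P * 'X^d)) =
  if (m + e == d)%N then \sum_(i < (m %/ e.+1).+1) mu i * q`_i else 0.
Proof.
rewrite /model_functional /= coefCM coefXn; case: eqP => _.
  by apply: eq_bigr => i _; rewrite mulr1.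
by apply: big1 => i _; rewrite mulr0 coef0 mulr0.
Qed.

End Functional.

Section LowerBound.
Variables (X : choiceType) (B : set (br X)) (le : rel (br X)).
Hypothesis hallB : is_hall_set B le.
Variables (x r z : X).
Hypothesis lt_xr : strict le (Leaf x) (Leaf r).
Hypothesis z_or : z = x \/ strict le (Leaf r) (Leaf z).
Variable K : numFieldType.
Variables (p m : nat).
Let e := z == x.
Hypothesis Hp : forall j, (j <= m)%N ->
  (j < p)%N = le (ad_chain le r j (Leaf x)) (Leaf r).

Let gen : X -> model K := model_gen x r z K.

Lemma pair_valueE j k : pair_value x z K j k =
  ('X^j - e%:R * 'X^k)%:P * 'X^(j + k).
Proof.
have XC n : ('X^n : {poly K})%:P = 'X%:P ^+ n by rewrite rmorphXn.
rewrite /pair_value /weight1 /weight2 polyCB polyCM !XC !exprMn -/e.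
have -> : (e%:R%:P : {poly {poly K}}) = e%:R by case: (e).
rewrite exprD; ring.
Qed.

Lemma weightDX l :
  (weight1 K + weight2 K) ^+ l = ((1 + 'X) ^+ l)%:P * 'X^l.
Proof.
by rewrite rmorphXn -exprMn /= polyCD polyC1 mulrDl mul1r addrC.
Qed.

Variable mu : nat -> K.
Hypothesis Hmu : forall j, (e.+1 * j <= m)%N ->
  \sum_(i < (m %/ e.+1).+1) mu i * (ladder_poly K e p m j)`_i =
  (-1) ^+ minn j p.

Let Lam : {scalar (model K)} := model_functional e m mu.

Let LamE (q : {poly K}) d : Lam (central (q%:P * 'X^d)) =
  if (m + e == d)%N then \sum_(i < (m %/ e.+1).+1) mu i * q`_i else 0.
Proof. exact: model_functional_monomial. Qed.

Lemma functional_low j l : (j < p)%N ->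
  Lam (central ((weight1 K + weight2 K) ^+ l * pair_value x z K j (e * j.+1))) =
  if (m == l + e.+1 * j)%N then (-1) ^+ minn j p else 0.
Proof.
move=> jp; rewrite pair_valueE weightDX.
rewrite mulrACA -exprD -polyCM LamE.
have -> : (m + e == l + (j + e * j.+1))%N = (m == l + e.+1 * j)%N.
  by apply/eqP/eqP; case: (e); lia.
case: eqP => // mE; have jm : (e.+1 * j <= m)%N by rewrite mE leq_addl.
have lE : (m - e.+1 * j = l)%N by rewrite mE addnK.
by rewrite -Hmu //; apply: eq_bigr => i _; rewrite /ladder_poly jp lE.
Qed.

Lemma functional_high j k : (p <= j)%N -> e ==> (j < k)%N ->
  Lam (central (pair_value x z K j k)) =
  if (m + e == j + k)%N then (-1) ^+ minn j p else 0.
Proof.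
move=> pj jk; rewrite pair_valueE LamE.
case: eqP => // mE; have jm : (e.+1 * j <= m)%N by case: (e) jk mE => /=; lia.
rewrite -Hmu //; apply: eq_bigr => i _; rewrite /ladder_poly ltnNge pj /=.
by have -> : (e * j.+1 + (m - e.+1 * j) = k)%N by case: (e) jk mE jm => /=; lia.
Qed.

Lemma functional_ladder j : (e.+1 * j <= m)%N ->
  Lam (ladder (lie (gen r)) e (lie_pair (gen r) (gen x) (gen z) e) p 0 m j) =
  (-1) ^+ minn j p.
Proof.
move=> jm; have xr := neq_xr lt_xr; have zr := neq_zr lt_xr z_or.
rewrite /ladder add0n; case: ifP => [jp|/negbT];
  rewrite /lie_pair (lie_iter_gen lt_xr z_or).
  by rewrite addn0 iter_ad_central functional_low // subnK // eqxx.
rewrite -leqNgt => pj; rewrite functional_high //; last by apply/implyP; lia.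
by case: eqP => //; case: (e) jm => /=; lia.
Qed.

(** Only low and high shapes can have a nonzero value. In total degree [m + e] they are rungs up to
    sign, where the form is 1 or -1; in other degrees it vanishes. *)
Lemma functional_hall_le1 c : B c -> `|Lam (ev gen c)| <= 1.
Proof.
move=> Bc; have xr := neq_xr lt_xr; have zr := neq_zr lt_xr z_or.
have Lam0 (v : model K) : v.2 = 0 -> Lam v = 0.
  move=> v0; rewrite /Lam /= /model_functional v0 big1 // => i _.
  by rewrite !coef0 mulr0.
have sgn_le n (b : bool) : `|(if b then (-1) ^+ n else 0 : K)| <= 1.
  by case: b; rewrite ?normr0 ?ler01 // normrX normrN1 expr1n.
case: (hall_shapeP hallB lt_xr z_or K Bc)
  => [->|k y yxz ->|->|j l le_j E|j k r_j jk E _ _].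
- by rewrite Lam0 ?normr0 ?ler01 //= /gen /model_gen eqxx.
- have yr : y != r by case: yxz => ->.
  have := ev_ad_chain le r gen k (Leaf y).
  rewrite [ev _ (Leaf y)]/= iter_ad_gen //.
  by case=> ->; rewrite ?linearN ?normrN Lam0 ?normr0 ?ler01.
- by rewrite linear0 normr0 ler01.
- have -> : `|Lam (ev gen c)| = `|Lam (central ((weight1 K + weight2 K) ^+ l *
      pair_value x z K j (e * j.+1)))|.
    by case: E => ->; rewrite ?linearN ?normrN.
  (* [Hp] says nothing for [j > m], but the total degree then exceeds [m + e]. *)
  have [jm|mj] := leqP j m; first by rewrite functional_low ?Hp.
  rewrite pair_valueE weightDX mulrACA -exprD -polyCM LamE.
  by case: eqP; rewrite ?normr0 ?ler01 // => ?; lia.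
- have -> : `|Lam (ev gen c)| = `|Lam (central (pair_value x z K j k))|.
    by case: E => ->; rewrite ?linearN ?normrN.
  have [jm|mj] := leqP j m.
    rewrite functional_high // leqNgt Hp //; apply/negP.
    have [Bj _] := chain_hall hallB j xr.
    exact: (hall_ltN hallB (hall_leaf hallB r) Bj r_j).
  rewrite pair_valueE LamE.
  case: eqP; rewrite ?normr0 ?ler01 // => mE.
  by move: (jk : e ==> _) mE mj; case: (e) => /=; lia.
Qed.

End LowerBound.

(** * Binomial sums and choice of distinct letters *)

Lemma sum_bin (m : nat) : (\sum_(j < m.+1) 'C(m, j) = 2 ^ m)%N.
Proof.
rewrite -[2%N]/(1 + 1)%N expnDn; apply: eq_bigr => j _.
by rewrite !exp1n !muln1.
Qed.

(** Pascal's rule splits a shallow diagonal of Pascal's triangle into the two preceding ones. *)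
Lemma sum_bin_diagonal (m : nat) : (\sum_(j < m.+1) 'C(m - j, j) = fib m.+1)%N.
Proof.
elim/ltn_ind: m => -[|[|m]] IHm; first by rewrite big_ord1.
  by rewrite big_ord_recl big_ord1.
rewrite -[fib _]/(fib m.+2 + fib m.+1)%N -!IHm //.
rewrite big_ord_recl big_ord_recr /= subnn bin0n addn0.
rewrite [in RHS]big_ord_recl /= !bin0 -addnA.
congr (_ + _)%N; rewrite -big_split; apply: eq_bigr => j _ /=.
rewrite /bump /= !add1n !subSS subSn ?binS //.
by rewrite -ltnS ltn_ord.
Qed.

Lemma distinct_letters (X : choiceType) (n : nat) :
  `I_n #<= [set: X] -> exists h : 'I_n -> X, injective h.
Proof.
move=> /card_leP[f].
have mem (k : 'I_n) : (k : nat) \in `I_n by rewrite inE /=.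
exists (fun k => val (f (SigSub (mem k)))) => j k /val_inj.
have jk := @inj _ _ _ f (SigSub (mem j)) (SigSub (mem k)).
by move/jk => /(_ (in_setT _) (in_setT _)) /(congr1 val) /= /val_inj.
Qed.

(** * Expansions in the free Lie algebra and the bound on the norm *)

Section FreeLie.
Variables (K : numFieldType) (X : choiceType).
Variables (L : lieAlgebraType K) (i : X -> L).
Variable B : set (br X).

Lemma lie_morphism_ev (M : lieAlgebraType K) (g : L -> M) (f : X -> M) :
  lie_morphism g -> g \o i =1 f -> forall t, g (ev i t) = ev f t.
Proof.
move=> [_ gM] gi; elim=> [y|s IHs t IHt] /=; first exact: gi.
by rewrite gM IHs IHt.
Qed.

(** The trees [c j] may repeat, so the coefficient of a tree gathers all its indices. *)
Lemma hall_expansion_lincomb (n : nat) (a : 'I_n -> K) (c : 'I_n -> br X) :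
  (forall j, B (c j)) ->
  exists alpha, hall_expansion i B (\sum_j a j *: ev i (c j)) alpha.
Proof.
move=> Bc; pose S := [fset c j | j in 'I_n]%fset.
have cS j : c j \in S by apply/imfsetP; exists j.
pose alpha : {fsfun br X -> K with 0} :=
  [fsfun t in S => \sum_(j | c j == t) a j].
have supp_sub : (finsupp alpha `<=` S)%fset.
  apply/fsubsetP => t; rewrite mem_finsupp fsfunE.
  by case: ifP => // _; rewrite eqxx.
exists alpha; split.
  by move=> t /(fsubsetP supp_sub) /imfsetP[j _ ->].
rewrite (big_fset_incl _ supp_sub); last first.
  by move=> t _; rewrite mem_finsupp negbK => /eqP ->; rewrite scale0r.
under [RHS]eq_big_seq => t tS.
  rewrite fsfunE tS scaler_suml big_mkcond; over.
rewrite exchange_big; apply: eq_bigr => j _ /=.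
rewrite (bigD1_seq (c j)) ?fset_uniq //= eqxx big1 ?addr0 // => t.
by rewrite eq_sym => /negbTE ->.
Qed.

End FreeLie.

Section Norm.
Variables (K : numFieldType) (X : choiceType).
Variables (L : lieAlgebraType K) (i : X -> L).
Variables (B : set (br X)) (le : rel (br X)).
Hypothesis freeL : is_free_lie i.
Hypothesis hallB : is_hall_set B le.
Variables (x r z : X).
Hypothesis lt_xr : strict le (Leaf x) (Leaf r).
Hypothesis z_or : z = x \/ strict le (Leaf r) (Leaf z).
Let e := z == x.

(** Guarantees that [hall_coords] picks a genuine expansion: [ladder_expansion] applies in [L], and
    its rungs are Hall up to sign. *)
Lemma hall_expansion_exists m :
  exists alpha, hall_expansion i B
    (lie (i x) (ev i (ad_chain le r (e + m) (Leaf z)))) alpha.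
Proof.
have xr := neq_xr lt_xr; have Bx := hall_leaf hallB x.
have [p Hp] := ad_chain_threshold hallB m Bx (leaf_ready le xr).
have ezx : e -> i z = i x by move/eqP ->.
have [beta [beta0 _ Gbeta]] := ladder_expansion (D := lie (i r))
  (fun c m => lie_pair_derivation (i r) c m ezx) p 0 m.
have term (sg : bool) (j : 'I_m.+1) : exists ac : K * br X, B ac.2 /\
    (-1) ^+ sg *: ((-1) ^+ minn j p *: (ladder (lie (i r)) e
      (lie_pair (i r) (i x) (i z) e) p 0 m j *+ beta j)) = ac.1 *: ev i ac.2.
  have [jm|mj] := leqP (e.+1 * j) m; last first.
    (* Out of range the coefficient is 0, and [Leaf x] is a dummy Hall tree. *)
    by exists (0, Leaf x); rewrite beta0 // mulr0n !scaler0 scale0r.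
  have [c [Bc Ec]] := ladder_hall hallB lt_xr z_or i Hp jm.
  have [s ->] : exists s : bool, ladder (lie (i r)) e
      (lie_pair (i r) (i x) (i z) e) p 0 m j = (-1) ^+ s *: ev i c.
    case: Ec => ->; [exists false|exists true];
      by rewrite ?expr1 ?scaleN1r ?opprK ?scale1r.
  exists ((-1) ^+ sg * ((-1) ^+ minn j p * ((-1) ^+ s *+ beta j)), c).
  by split=> //=; rewrite scalerMnl !scalerA mulrA.
have [sg ->] : exists sg : bool,
    lie (i x) (ev i (ad_chain le r (e + m) (Leaf z))) =
    (-1) ^+ sg *: lie_pair (i r) (i x) (i z) e 0 m.
  rewrite /lie_pair muln1.
  case: (ev_ad_chain le r i (e + m) (Leaf z)) => ->.
    by exists false; rewrite scale1r.
  by exists true; rewrite lieNr expr1 scaleN1r.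
have /choice[ac Hac] := term sg.
rewrite Gbeta scaler_sumr; under eq_bigr => j _ do rewrite (Hac j).2.
by apply: hall_expansion_lincomb => j; case: (Hac j).
Qed.

(** The form on the model, pulled back to [L] by the universal property, is at most 1 in absolute
    value on Hall elements; its value at [u] therefore bounds the norm from below. *)
Lemma hall_norm_ge m :
  (\sum_(j < m.+1) 'C(m - e * j, j))%:R <=
  hall_norm i B (lie (i x) (ev i (ad_chain le r (e + m) (Leaf z)))).
Proof.
set u := lie _ _; have [suppB uE] := xgetPex [fsfun] (hall_expansion_exists m).
rewrite /hall_norm -/(hall_coords i B u) in suppB uE *.
set alpha := hall_coords i B u in suppB uE *.
have xr := neq_xr lt_xr; have zr := neq_zr lt_xr z_or.
have Bx := hall_leaf hallB x.
have [p Hp] := ad_chain_threshold hallB m Bx (leaf_ready le xr).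
pose gen : X -> model K := model_gen x r z K.
have [[g [gmor gi]] _] := freeL gen.
(* The form takes on each rung the sign this rung carries in [ladder_expansion], so all coefficients
   add up. *)
have [mu Hmu] := ladder_dual e p m (fun j => (-1) ^+ minn j p : K).
pose Lam : {scalar (model K)} := model_functional e m mu.
pose gl : {linear L -> model K} :=
  HB.pack g (GRing.isLinear.Build _ _ _ _ g gmor.1).
have ezx : e -> gen z = gen x by move/eqP ->.
have [beta [beta0 betaC Gbeta]] := ladder_expansion (D := lie (gen r))
  (fun c m => lie_pair_derivation (gen r) c m ezx) p 0 m.
(* As [x] is below [r], the threshold is positive and the binomial bound holds for every [j]. *)
have p_gt0 : (0 < p)%N by rewrite (Hp 0%N) //; apply: hall_ltW lt_xr.
have LamG : Lam (lie_pair (gen r) (gen x) (gen z) e 0 m) =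
    (\sum_(j < m.+1) beta j)%:R.
  rewrite Gbeta linear_sum natr_sum; apply: eq_bigr => j _.
  rewrite linearZ linearMn /=; have [jm|mj] := leqP (e.+1 * j) m; last first.
    by rewrite beta0 // !mulr0n mulr0.
  rewrite [X in _ * (X *+ _)](functional_ladder lt_xr z_or Hmu jm).
  by rewrite mulrnAr -signr_odd -expr2 sqrr_sign.
have norm_u : `|Lam (g u)| = (\sum_(j < m.+1) beta j)%:R.
  rewrite -(ger0_norm (ler0n K (\sum_(j < m.+1) beta j))) -LamG.
  have -> : g u = lie (gen x) (ev gen (ad_chain le r (e + m) (Leaf z))).
    by rewrite /u gmor.2 (lie_morphism_ev gmor gi) -(gi x).
  rewrite /lie_pair muln1.
  case: (ev_ad_chain le r gen (e + m) (Leaf z)) => ->;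
    by rewrite ?lieNr ?linearN ?normrN.
apply: (@le_trans _ _ (\sum_(j < m.+1) beta j)%:R).
  by rewrite ler_nat; apply: leq_sum => j _; apply: betaC; rewrite p_gt0.
rewrite -norm_u; have -> : g u = \sum_(c <- finsupp alpha) alpha c *: ev gen c.
  rewrite [LHS](congr1 gl uE) linear_sum; apply: eq_bigr => c _.
  by rewrite linearZ /= (lie_morphism_ev gmor gi).
rewrite linear_sum.
apply: le_trans (ler_norm_sum _ _ _) _.
rewrite big_seq [leRHS]big_seq; apply: ler_sum => c calpha.
rewrite linearZ /= normrM ler_piMr //.
exact: (functional_hall_le1 hallB lt_xr z_or Hp Hmu (suppB c calpha)).
Qed.

End Norm.

(** * Choice of the letters and of the two trees *)

Section Witness.
Variables (X : choiceType) (B : set (br X)) (le : rel (br X)).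
Hypothesis hallB : is_hall_set B le.

(** Once above [r] a chain is above [x]; before that, a chain over [x] increases strictly from
    [x]. *)
Lemma lt_leaf_ad_chain (x r z : X) (k : nat) :
  strict le (Leaf x) (Leaf r) ->
  (z = x /\ (0 < k)%N) \/ strict le (Leaf r) (Leaf z) ->
  strict le (Leaf x) (ad_chain le r k (Leaf z)).
Proof.
move=> lt_xr z_or; have Bl y := hall_leaf hallB y.
have okx := leaf_ready le (neq_xr lt_xr).
have zr : z != r.
  by apply: (neq_zr lt_xr); case: z_or => [[]|]; [left|right].
have okz := leaf_ready le zr; have [Bk _] := chain_hall hallB k zr.
have above j : (j <= k)%N -> strict le (Leaf r) (ad_chain le r j (Leaf z)) ->
    strict le (Leaf x) (ad_chain le r k (Leaf z)).
  move=> jk /(ad_chain_above hallB (Bl z) okz jk).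
  exact: (hall_lt_trans hallB (Bl x) (Bl r) Bk).
case: z_or => [[zx k0]|]; last exact: (above 0%N).
have [Bk1 _] := chain_hall hallB k.-1 zr.
have [le_k|/negbTE/(hall_nle hallB Bk1 (Bl r))] :=
  boolP (le (ad_chain le r k.-1 (Leaf z)) (Leaf r)).
  have := ad_chain_increasing hallB (Bl z) okz k0 le_k.
  by rewrite [ad_chain le r 0 _]/= [in Leaf z]zx.
by apply: above; apply: leq_pred.
Qed.

Lemma hall_leaf_lt (a b : X) : a != b ->
  strict le (Leaf a) (Leaf b) \/ strict le (Leaf b) (Leaf a).
Proof.
have Bl y := hall_leaf hallB y => ab.
have [le_ab|/negbTE/(hall_nle hallB (Bl a) (Bl b))] :=
  boolP (le (Leaf a) (Leaf b)).
  by left; rewrite /strict le_ab andbT; apply: contra ab => /eqP[->].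
by right.
Qed.

Lemma sorted_letters (h : 'I_3 -> X) : injective h -> exists x r z,
  strict le (Leaf x) (Leaf r) /\ strict le (Leaf r) (Leaf z).
Proof.
move=> h_inj; have ne (j k : 'I_3) : j != k -> h j != h k.
  by apply: contra => /eqP/h_inj ->.
pose o k := inord k : 'I_3; have neo j k : j != k -> (j < 3)%N -> (k < 3)%N ->
    h (o j) != h (o k).
  by move=> jk j3 k3; apply: ne; rewrite -val_eqE /= !inordK.
have [h01|h10] := hall_leaf_lt (neo 0 1 isT isT isT);
have [h12|h21] := hall_leaf_lt (neo 1 2 isT isT isT);
have [h02|h20] := hall_leaf_lt (neo 0 2 isT isT isT);
  (* Two consecutive comparisons suffice, so the two cyclic cases are also covered by the list. *)
  by [exists (h (o 0)), (h (o 1)), (h (o 2))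
     |exists (h (o 0)), (h (o 2)), (h (o 1))
     |exists (h (o 1)), (h (o 0)), (h (o 2))
     |exists (h (o 1)), (h (o 2)), (h (o 0))
     |exists (h (o 2)), (h (o 0)), (h (o 1))
     |exists (h (o 2)), (h (o 1)), (h (o 0))].
Qed.

End Witness.

Theorem theorem1p4 (R : realType) (k : scalar_kind) (X : choiceType)
    (L : lieAlgebraType (base_field R k)) (i : X -> L)
    (B : set (br X)) (le : rel (br X)) (n : nat) :
  is_free_lie i ->
  `I_2 #<= [set: X] ->
  is_hall_set B le ->
  (3 <= n)%N ->
  exists a b : br X,
    [/\ B a, B b, strict le a b, br_size a = 1%N & br_size b = n.-1] /\
    (`I_3 #<= [set: X] ->
       (2 ^ (n - 2))%:R <= hall_norm i B (lie (ev i a) (ev i b))) /\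
    ([set: X] #= `I_2 ->
       (fib (n - 2))%:R <= hall_norm i B (lie (ev i a) (ev i b))).
Proof.
move=> freeL X2 hallB n3; have Bl y := hall_leaf hallB y.
(* A third letter allows [z] above [r], giving full binomial sums; otherwise [z = x], giving
   diagonal ones. *)
have [X3|/negP notX3] := boolP (`I_3 #<= [set: X]).
  have [h /(sorted_letters hallB)[x [r [z [lt_xr lt_rz]]]]] :=
    distinct_letters X3.
  have zr := neq_zr lt_xr (or_intror lt_rz).
  have zxF := neq_zx hallB lt_xr lt_rz.
  have [Bb _] := chain_hall hallB (n - 2) zr.
  exists (Leaf x), (ad_chain le r (n - 2) (Leaf z)); split; last split.
  - split=> //; last by rewrite br_size_ad_chain /=; lia.
    by apply: (lt_leaf_ad_chain hallB) => //; right.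
  - move=> _; have := hall_norm_ge freeL hallB lt_xr (or_intror lt_rz) (n - 2).
    rewrite zxF add0n /= -sum_bin.
    by under eq_bigr do rewrite mul0n subn0.
  - move=> X2'; have : `I_3 #<= `I_2.
      by apply: card_le_trans X3 _; move: X2'; rewrite card_eq_le => /andP[].
    by rewrite card_le_II.
have [h h_inj] := distinct_letters X2.
have [x [r lt_xr]] : exists x r, strict le (Leaf x) (Leaf r).
  have : h ord0 != h ord_max by apply/eqP => /h_inj.
  by case/(hall_leaf_lt hallB) => lt_h;
    [exists (h ord0)|exists (h ord_max)]; eexists; exact: lt_h.
have [Bb _] := chain_hall hallB (n - 2) (neq_xr lt_xr).
exists (Leaf x), (ad_chain le r (n - 2) (Leaf x)); split; last split=> // _.
  split=> //; last by rewrite br_size_ad_chain /=; lia.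
  by apply: (lt_leaf_ad_chain hallB) => //; left; split=> //; lia.
(* The chain has length [n - 2 = e + m] with [e] equal to 1, whence [m = n - 3]. *)
have := hall_norm_ge freeL hallB lt_xr (or_introl (erefl x)) (n - 3).
rewrite eqxx; under eq_bigr do rewrite mul1n; rewrite sum_bin_diagonal add1n.
by have -> : (n - 3).+1 = (n - 2)%N by lia.
Qed.
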